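(* Let $X$ be a completely regular Hausdorff space and let $\mathcal{P}$ be an ideal of closed sets in $X$. Suppose that either $X$ has no isolated point or each singleton subset of $X$ is a member of $\mathcal{P}$. Let $S$ be the socle of $C(X)$. Then: (1) $C_{\mathcal{P}}(X)=S$ if and only if $X$ is $\mathcal{P}$-pseudodiscrete; (2) $C^{\mathcal{P}}_{\infty}(X)=S$ if and only if $X$ is $\mathcal{P}$-pseudodiscrete and contains at most finitely many isolated points.
   Context: $C(X)$ is the ring of all real-valued continuous functions on $X$; $Z(f)=\{x\in X: f(x)=0\}$. An ideal of closed sets in $X$ is a nonempty family $\mathcal{P}$ of closed subsets of $X$ such that (i) $A,B\in\mathcal{P}$ implies $A\cup B\in\mathcal{P}$, and (ii) $A\in\mathcal{P}$, $B\subseteq A$ with $B$ closed in $X$ implies $B\in\mathcal{P}$. $C_{\mathcal{P}}(X)=\{f\in C(X): \mathrm{cl}_X(X\setminus Z(f))\in\mathcal{P}\}$ and $C^{\mathcal{P}}_{\infty}(X)=\{f\in C(X): \{x\in X: |f(x)|\geq\epsilon\}\in\mathcal{P}\text{ for each }\epsilon>0\}$. The socle $S$ of $C(X)$ is the intersection of all essential ideals of $C(X)$, where a nonzero ideal is essential if it intersects each nonzero ideal nontrivially; it is known that $S$ consists precisely of those $f\in C(X)$ for which $X\setminus Z(f)$ is finite. $X$ is $\mathcal{P}$-pseudodiscrete if each member of $\mathcal{P}$ has finite interior in $X$. *)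

(* Defs.v *)
From HB Require Import structures.
From mathcomp Require Import all_boot all_order all_algebra.
From mathcomp Require Import all_classical all_reals all_analysis.
Set Implicit Arguments.
Unset Strict Implicit.
Unset Printing Implicit Defensive.
Import Order.TTheory GRing.Theory Num.Theory.
Import numFieldNormedType.Exports.
Local Open Scope classical_set_scope.
Local Open Scope ring_scope.

(* The pointwise commutative ring structure on [continuousType X R].  It is only
   a [comPzRingType]: when [X] is empty this is the zero ring. *)
Section continuous_ring.
Context {R : realType} {X : topologicalType}.
Implicit Types f g h : continuousType X R.

Definition cfun0 : continuousType X R := mkcts (@cst_continuous X R 0).

Definition cfun1 : continuousType X R := mkcts (@cst_continuous X R 1).

Lemma cfun_opp_continuous f : continuous (\- f : X -> R).
Proof. by move=> x; apply: cvgN; exact: cts_fun. Qed.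

Lemma cfun_add_continuous f g : continuous (f \+ g : X -> R).
Proof. by move=> x; apply: cvgD; exact: cts_fun. Qed.

Lemma cfun_mul_continuous f g : continuous (f \* g : X -> R).
Proof. by move=> x; apply: cvgM; exact: cts_fun. Qed.

Definition cfun_opp f : continuousType X R := mkcts (@cfun_opp_continuous f).

Definition cfun_add f g : continuousType X R :=
  mkcts (@cfun_add_continuous f g).

Definition cfun_mul f g : continuousType X R :=
  mkcts (@cfun_mul_continuous f g).

Lemma cfun_addA : associative cfun_add.
Proof. by move=> f g h; apply/continuousEP => x /=; exact: addrA. Qed.

Lemma cfun_addC : commutative cfun_add.
Proof. by move=> f g; apply/continuousEP => x /=; exact: addrC. Qed.

Lemma cfun_add0 : left_id cfun0 cfun_add.
Proof. by move=> f; apply/continuousEP => x /=; exact: add0r. Qed.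

Lemma cfun_addN : left_inverse cfun0 cfun_opp cfun_add.
Proof. by move=> f; apply/continuousEP => x /=; exact: addNr. Qed.

Lemma cfun_mulA : associative cfun_mul.
Proof. by move=> f g h; apply/continuousEP => x /=; exact: mulrA. Qed.

Lemma cfun_mulC : commutative cfun_mul.
Proof. by move=> f g; apply/continuousEP => x /=; exact: mulrC. Qed.

Lemma cfun_mul1 : left_id cfun1 cfun_mul.
Proof. by move=> f; apply/continuousEP => x /=; exact: mul1r. Qed.

Lemma cfun_mulDl : left_distributive cfun_mul cfun_add.
Proof. by move=> f g h; apply/continuousEP => x /=; exact: mulrDl. Qed.

HB.instance Definition _ := GRing.isZmodule.Build (continuousType X R)
  cfun_addA cfun_addC cfun_add0 cfun_addN.

HB.instance Definition _ :=
  GRing.Zmodule_isComPzRing.Build (continuousType X R)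
    cfun_mulA cfun_mulC cfun_mul1 cfun_mulDl.

End continuous_ring.

Section ideals.
Context {A : comPzRingType}.
Implicit Types I J : set A.

(* Not required to be proper, unlike [ring_quotient.idealr_closed]. *)
Definition is_ideal I :=
  [/\ I 0, (forall a b, I a -> I b -> I (a + b)) &
      (forall r a, I a -> I (r * a))].

Definition essential_ideal I :=
  [/\ is_ideal I, I <> [set 0] &
      forall J, is_ideal J -> J <> [set 0] -> I `&` J <> [set 0]].

End ideals.

Definition socle (A : comPzRingType) : set A :=
  \bigcap_(I in [set I : set A | essential_ideal I]) I.

Arguments socle A : clear implicits.

Section closed_set_ideals.
Context {X : topologicalType}.

Definition closed_set_ideal (P : set (set X)) :=
  [/\ P !=set0, P `<=` closed,
      (forall A B, P A -> P B -> P (A `|` B)) &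
      (forall A B, P A -> B `<=` A -> closed B -> P B)].

Definition pseudodiscrete (P : set (set X)) :=
  forall A, P A -> finite_set (interior A).

End closed_set_ideals.

Section support_rings.
Context (R : realType) {X : topologicalType}.

Definition zero_set (f : continuousType X R) : set X := [set x | f x = 0].

Definition C_supp (P : set (set X)) : set (continuousType X R) :=
  [set f | P (closure (~` zero_set f))].

Definition C_infty (P : set (set X)) : set (continuousType X R) :=
  [set f | forall e : R, 0 < e -> P [set x | e <= `|f x|]].

End support_rings.

Arguments C_supp R {X} P.
Arguments C_infty R {X} P.

(* Main.v *)
(* In a completely regular Hausdorff space the socle consists of the functions
   with finite cozero set: such a set consists of isolated points, whose
   indicators lie in every essential ideal, while the ideals
   [{g | g x = 0}], with [x] not isolated, and [{g | g = 0 at all but finitely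
   many points of E}], with [E] an infinite set of isolated points, are
   essential.
   If a member of [P] has infinite interior, then either this interior contains
   a non-isolated point, and separating it from the complement gives an element
   of [C_supp R P] with infinite cozero set, or it is a set of isolated points,
   and a function tending to [0] along a sequence of them does.  The same
   function, for infinitely many isolated points, lies in [C_infty R P]. *)
Require Import Defs.
From mathcomp Require Import all_boot all_order all_algebra.
From mathcomp Require Import all_classical all_reals all_analysis.
Set Implicit Arguments.
Unset Strict Implicit.
Unset Printing Implicit Defensive.
Import Order.TTheory GRing.Theory Num.Theory.
Import numFieldNormedType.Exports.
Local Open Scope classical_set_scope.
Local Open Scope ring_scope.

Lemma infinite_set_injseq (T : Type) (A : set T) :
  infinite_set A -> exists2 u : nat -> T, injective u & forall n, A (u n).
Proof.
move=> /infiniteP/card_leP[f].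
exists (fun n => val (f (SigSub (mem_setT n)))).
  by move=> m n /val_inj /(@inj _ _ _ f) -/(_ (in_setT _) (in_setT _)) [].
by move=> n; apply: set_mem; exact: (valP (f (SigSub (mem_setT n)))).
Qed.

(** * Isolated points and finite open sets *)

Section isolated_points.
Context {X : topologicalType}.
Implicit Types (x : X) (A U D : set X).

Lemma isolatedTP x : isolated [set: X] x <-> nbhs x [set x].
Proof.
split=> [[_ [V Vx]]|xx]; first by rewrite setIT => <-.
by split; [exact: in_setT|exists [set x] => //; rewrite setIT].
Qed.

(** The points of [U] other than [x] form a finite, hence closed, set; removing it from [U] leaves
    the open set [{x}]. *)
Lemma open_finite_isolated U :
  accessible_space X -> open U -> finite_set U -> U `<=` isolated [set: X].
Proof.
move=> accX oU finU x Ux; apply/isolatedTP.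
have oD : open (~` (U `\ x)).
  apply: closed_openC; apply: (accessible_finite_set_closed.1 accX).
  exact: finite_setD.
apply: (filterS (P := U `&` ~` (U `\ x))).
  by move=> y [Uy nUxy]; apply: contrapT => yx; apply: nUxy.
apply: filterI; first exact: open_nbhs_nbhs.
by apply: open_nbhs_nbhs; split=> // -[_]; apply.
Qed.

End isolated_points.

(** * Continuous functions from separation and from isolated points *)

Section functions.
Context {R : realType} {X : topologicalType}.
Implicit Types (x y : X) (A B D : set X) (f g : continuousType X R).

Lemma open_cozero f : open (~` zero_set f).
Proof.
apply: closed_openC; apply: (@closed_comp _ _ f [set r : R | r = 0]).
  by move=> x _; exact: cts_fun.
exact: closed_eq.
Qed.

Lemma cfun_neq0 f : f <> 0 -> exists x, f x <> 0.
Proof.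
move=> f0; apply: contrapT => nf; apply: f0; apply/continuousEP => x.
by apply: contrapT => fx; apply: nf; exists x.
Qed.

Lemma completely_regular_separation x B :
  completely_regular_space X -> closed B -> ~ B x ->
  exists f : continuousType X R, f x = 1 /\ forall y, B y -> f y = 0.
Proof.
move=> crX cB nBx.
have /(@uniform_separatorP X R)[f [cf _ f0 f1]] := crX x B cB nBx.
(* The separator [f] is 0 at [x] and 1 on [B], so the roles of the two values are swapped. *)
have cg : continuous (fun y => 1 - f y : R).
  by move=> y; apply: cvgB; [exact: cvg_cst|exact: cf].
exists (mkcts cg); split=> [|y By] /=.
  by rewrite /mkcts (f0 (f x)) ?subr0//; exists x.
by rewrite /mkcts (f1 (f y)) ?subrr//; exists y.
Qed.

(* For such a function every point outside the finite set [{x | e <= |g x|}] is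
   either isolated or a zero with a neighbourhood on which [|g| < e]. *)
Lemma continuous_isolated_support (g : X -> R) :
  accessible_space X ->
  (forall x, g x <> 0 -> isolated [set: X] x) ->
  (forall e, 0 < e -> finite_set [set x | e <= `|g x|]) ->
  continuous g.
Proof.
move=> accX isog fing x; have [gx0|/isog/isolatedTP xx] := pselect (g x = 0).
  apply/cvgrPdist_lt => e e0; rewrite gx0.
  apply: (filterS (P := ~` [set y | e <= `|g y|])) => [y /= /negP|].
    by rewrite -ltNge sub0r normrN.
  apply: open_nbhs_nbhs; split; last by rewrite /= gx0 normr0 leNgt e0.
  apply: closed_openC; apply: (accessible_finite_set_closed.1 accX); exact: fing.
by apply/cvgrPdist_lt => e e0; apply: filterS xx => y ->; rewrite subrr normr0.
Qed.

Lemma exists_point_indicator x :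
  accessible_space X -> isolated [set: X] x ->
  exists f : continuousType X R, f x = 1 /\ forall y, y <> x -> f y = 0.
Proof.
move=> accX isox; pose g y : R := \1_[set x] y.
have gx : g x = 1 by rewrite /g indicE mem_set.
have gN y : y <> x -> g y = 0 by move=> yx; rewrite /g indicE memNset.
have cg : continuous g.
  apply: continuous_isolated_support => // [y gy|e e0].
    by suff -> : y = x by []; apply: contrapT => /gN.
  apply: (sub_finite_set _ (finite_set1 x)) => y /= ey.
  by apply: contrapT => /gN gy; move: ey; rewrite gy normr0 leNgt e0.
by exists (mkcts cg).
Qed.

(* The function takes the value [1/(n+1)] at the [n]th term of a sequence of
   distinct points of [D]. *)
Lemma exists_infinite_cozero D :
  accessible_space X -> D `<=` isolated [set: X] -> infinite_set D ->
  exists f : continuousType X R,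
    [/\ infinite_set (~` zero_set f), ~` zero_set f `<=` D &
        forall e : R, 0 < e -> finite_set [set x | e <= `|f x|]].
Proof.
move=> accX isoD /infinite_set_injseq[u uinj uD].
(* Injectivity of [u] makes the index of a point unique, so the value is well defined; points off
   the sequence get 0. *)
have /choice[g gP] y : exists r : R,
    (forall n, u n = y -> r = n.+1%:R^-1) /\ ((forall n, u n <> y) -> r = 0).
  have [[n uny]|nu] := pselect (exists n, u n = y).
    exists n.+1%:R^-1; split=> [m|/(_ n)//].
    by rewrite -uny => /uinj ->.
  by exists 0; split=> // n uny; case: nu; exists n.
have gu n : g (u n) = n.+1%:R^-1 by case: (gP (u n)) => + _; apply.
have gN y : g y <> 0 -> exists n, u n = y.
  move=> gy; apply: contrapT => nu; apply: gy; case: (gP y) => _; apply => n uny.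
  by apply: nu; exists n.
have fing e : 0 < e -> finite_set [set x | e <= `|g x|].
  move=> e0.
  (* From [e <= 1/(n+1)] follows [n+1 <= 1/e], so [n] is at most the integer part of [1/e]. *)
  apply: (@sub_finite_set _ _ (u @` `I_(Num.trunc e^-1).+1)); last first.
    by apply: finite_image; exact: finite_II.
  move=> y /= egy; have [n uny] : exists n, u n = y.
    by apply: gN => gy; move: egy; rewrite gy normr0 leNgt e0.
  exists n => //=; move: egy; rewrite -uny gu ger0_norm// => en.
  rewrite ltnS truncn_ge_nat; last by rewrite invr_ge0 ltW.
  apply: (@le_trans _ _ n.+1%:R); first by rewrite ler_nat.
  by rewrite -[leLHS]invrK lef_pV2// posrE invr_gt0.
have cg : continuous g.
  apply: continuous_isolated_support => // y /gN[n <-].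
  exact/isoD/uD.
exists (mkcts cg); split=> // [|y /= /gN[n <-]//].
move=> /(finite_preimage (f := u)) fu; apply: infinite_nat.
apply: (sub_finite_set _ (fu _)) => [n _ /=|m n _ _ /uinj//].
by rewrite /zero_set/= /mkcts gu; apply/eqP; rewrite invr_eq0 pnatr_eq0.
Qed.
End functions.

(** * Essential ideals tested on multiples of single elements *)

Section essential_ideals.
Context {A : comPzRingType}.
Implicit Types (I : set A) (a b : A).

Lemma principal_is_ideal a : is_ideal [set r * a | r in [set: A]].
Proof.
split; first by exists 0; rewrite ?mul0r.
- by move=> _ _ [r _ <-] [s _ <-]; exists (r + s); rewrite ?mulrDl.
- by move=> r _ [s _ <-]; exists (r * s); rewrite ?mulrA.
Qed.

(** A nonzero multiple in [I] of an element of [J] stays in [J]; the case [a = 1] shows that [I] is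
    nonzero. *)
Lemma essential_ideal_mul I : is_ideal I -> (1 <> 0 :> A) ->
  (forall a, a <> 0 -> exists b, I (b * a) /\ b * a <> 0) -> essential_ideal I.
Proof.
move=> idI A10 mulI; split=> // [I0|J [J0 _ mulJ] Jneq0 IJ0].
  by have [b [+]] := mulI _ A10; rewrite I0.
apply: Jneq0; apply/seteqP; split=> [a Ja|_ ->//].
apply: contrapT => /mulI[b [Iba ba0]]; apply: ba0.
have : (I `&` J) (b * a) by split=> //; exact: mulJ.
by rewrite IJ0.
Qed.

(** Essentiality is applied to the principal ideal generated by [a]. *)
Lemma mul_mem_essential_ideal I a : essential_ideal I -> a <> 0 ->
  exists b, I (b * a) /\ b * a <> 0.
Proof.
move=> [[I0 _ _] _ essI] a0; apply: contrapT => nb.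
apply: (essI _ (principal_is_ideal a)).
  by move=> aA; apply: a0; rewrite -[LHS]mul1r -[_ = _]/([set 0] _) -aA; exists 1.
apply/seteqP; split=> [_ [/[swap]] [b _ <-] Iba|_ -> /=].
  by apply: contrapT => ba0; apply: nb; exists b.
by split=> //; exists 0; rewrite ?mul0r.
Qed.

End essential_ideals.

(** * The socle of the ring of continuous functions *)

Section socle.
Context {R : realType} {X : topologicalType}.
Hypotheses (accX : accessible_space X) (crX : completely_regular_space X).
Implicit Types (x y : X) (f g : continuousType X R).

Lemma cfun1_neq0 x : (1 : continuousType X R) <> 0.
Proof. by move=> /continuousEP/(_ x)/eqP; rewrite (oner_eq0 R). Qed.

(** The open cozero set of a nonzero [g] cannot be [{x}], so it contains some [y <> x]; a function
    that is 1 at [y] and 0 at [x] multiplies [g] into the ideal without killing it. *)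
Lemma essential_vanishing_at x :
  ~ isolated [set: X] x ->
  essential_ideal [set g : continuousType X R | g x = 0].
Proof.
move=> nisox; apply: essential_ideal_mul => [||g /cfun_neq0[y0 gy0]].
- split=> //= [a b /= ax bx|r a /= ax].
    by rewrite -[LHS]/(a x + b x) ax bx addr0.
  by rewrite -[LHS]/(r x * a x) ax mulr0.
- exact: cfun1_neq0 x.
have [y gy yx] : exists2 y, g y <> 0 & y <> x.
  apply: contrapT => ny; apply: nisox; apply/isolatedTP.
  have gx y : g y <> 0 -> y = x.
    by move=> gy; apply: contrapT => yx; apply: ny; exists y.
  apply: (filterS (P := ~` zero_set g)); first by move=> y /gx.
  apply: open_nbhs_nbhs; split; first exact: open_cozero.
  by rewrite -(gx _ gy0).
have [h [hy hx]] := completely_regular_separation (R := R) crX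
  (accessible_closed_set1 accX (x := x)) yx.
exists h; split; first by rewrite /= -[LHS]/(h x * g x) hx// mul0r.
move=> /continuousEP/(_ y); rewrite -[LHS]/(h y * g y) hy mul1r.
exact: gy.
Qed.

(** A nonzero [g] either vanishes on [E], and is then in the ideal, or is nonzero at some [y] in
    [E], and its product with the indicator of [y] is a nonzero member. *)
Lemma essential_finite_on (E : set X) :
  E `<=` isolated [set: X] -> infinite_set E ->
  essential_ideal [set g : continuousType X R | finite_set (E `\` zero_set g)].
Proof.
move=> isoE infE; apply: essential_ideal_mul => [||g g0].
- split=> /=.
  + by apply: (sub_finite_set _ (finite_set0 _)) => y [_]; apply.
  + move=> a b fa fb; have /sub_finite_set : E `\` zero_set (a + b) `<=`
      (E `\` zero_set a) `|` (E `\` zero_set b).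
      move=> y [Ey aby]; apply: contrapT => /not_orP[ay by_].
      apply: aby; rewrite /zero_set/= -[LHS]/(a y + b y).
      rewrite (_ : a y = 0); last by apply: contrapT => ?; apply: ay.
      rewrite (_ : b y = 0); last by apply: contrapT => ?; apply: by_.
      by rewrite addr0.
    by apply; rewrite finite_setU.
  + move=> r a; apply: sub_finite_set => y [Ey ray]; split=> // ay; apply: ray.
    by rewrite /zero_set/= -[LHS]/(r y * a y) ay mulr0.
- by have [x _] := infinite_setN0 infE; exact: cfun1_neq0 x.
have [[y [Ey gy]]|nE] := pselect (exists y, E y /\ g y <> 0); last first.
  exists 1; rewrite mul1r; split=> //=.
  apply: (sub_finite_set _ (finite_set0 _)) => y [Ey gy].
  by apply: nE; exists y.
have [h [hy hN]] := exists_point_indicator (R := R) accX (isoE _ Ey).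
exists h; split=> /=.
  apply: (sub_finite_set _ (finite_set1 y)) => z [_] hgz.
  apply: contrapT => zy; apply: hgz.
  by rewrite /zero_set/= -[LHS]/(h z * g z) hN// mul0r.
move=> /continuousEP/(_ y); rewrite -[LHS]/(h y * g y) hy mul1r.
exact: gy.
Qed.

Lemma socle_finite_cozero :
  socle (continuousType X R) = [set f | finite_set (~` zero_set f)].
Proof.
apply/seteqP; split=> [f Sf|f /= finf I /= essI].
  have isof : ~` zero_set f `<=` isolated [set: X].
    move=> x fx; apply: contrapT => nisox.
    exact/fx/(Sf _ (essential_vanishing_at nisox)).
  (* With [E] the cozero set of [f], membership in this ideal says that the cozero set is finite. *)
  apply: contrapT => inff; have /= := Sf _ (essential_finite_on isof inff).
  by rewrite setDE setIid.
have [[I0 ID IM] _ _] := essI; have /finite_seqP[s fs] := finf.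
(* Only the inclusion is kept, since the induction on [s] changes [f] and may meet points where it
   vanishes. *)
have {fs} : ~` zero_set f `<=` [set` s] by rewrite fs.
elim: s f finf => [|x s IHs] f finf fs.
  suff -> : f = 0 by [].
  by apply/continuousEP => x; apply: contrapT => /fs.
have [fx|fx] := pselect (f x = 0).
  apply: IHs => // y fy; have := fs _ fy; rewrite /= inE => /orP[/eqP yx|//].
  by case: fy; rewrite yx.
have isox := open_finite_isolated accX (open_cozero f) finf fx.
have [e [ex eN]] := exists_point_indicator (R := R) accX isox.
have e0 : e <> 0.
  by move=> /continuousEP/(_ x)/eqP; rewrite ex (oner_eq0 R).
have [b [Ibe be0]] := mul_mem_essential_ideal essI e0.
have bx : b x <> 0.
  move=> bx; apply: be0; apply/continuousEP => y; rewrite -[LHS]/(b y * e y).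
  have [->|/eqP yx] := eqVneq y x; first by rewrite bx mul0r.
  by rewrite eN// mulr0.
(* As [e] lives only at [x], [b * e] is the multiple of [e] by the nonzero constant [b x], which can
   be divided out. *)
have Ie : I e.
  have cb : continuous (fun _ : X => (b x)^-1 : R) by exact: cst_continuous.
  suff -> : e = (mkcts cb : continuousType X R) * (b * e) by exact: IM.
  apply/continuousEP => y; rewrite -[RHS]/((b x)^-1 * (b y * e y)).
  have [->|/eqP yx] := eqVneq y x; last by rewrite eN// !mulr0.
  by rewrite mulrA mulVf ?mul1r//; apply/eqP.
(* Subtracting [f * e] removes exactly [x] from the cozero set, so the remainder falls under the
   induction hypothesis. *)
rewrite -(subrK (f * e) f); apply: (ID); last exact: IM.
have fe y : (f - f * e) y = f y - f y * e y by [].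
have sub y : (f - f * e) y <> 0 -> f y <> 0 /\ y <> x.
  rewrite fe => fey; split=> [fy|yx]; apply: fey; first by rewrite fy mul0r subrr.
  by rewrite yx ex mulr1 subrr.
apply: IHs => [|y /sub[fy yx]]; first by apply: sub_finite_set finf => y /sub[].
by have := fs _ fy; rewrite /= inE => /orP[/eqP|].
Qed.

End socle.

(** * Ideals of closed sets and their function rings *)

Section closed_set_ideal_theory.
Context {R : realType} {X : topologicalType} (P : set (set X)).
Hypothesis idP : closed_set_ideal P.

Lemma closed_set_ideal0 : P set0.
Proof. by have [[A PA] _ _ sP] := idP; apply: sP PA _ closed0. Qed.

Lemma closed_set_ideal_finite (A : set X) :
  (forall x, A x -> P [set x]) -> finite_set A -> P A.
Proof.
move=> PA /finite_seqP[s As]; rewrite {}As in PA *; have [_ _ PU _] := idP.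
elim: s PA => [|x s IHs] Ps; first by rewrite set_nil; exact: closed_set_ideal0.
have -> : [set` x :: s] = [set x] `|` [set` s].
  by apply/predeqP => y /=; rewrite inE; apply: iff_sym; exact: (rwP predU1P).
apply: PU; first by apply: Ps; rewrite /= mem_head.
by apply: IHs => y ys; apply: Ps; rewrite /= inE ys orbT.
Qed.

(** The set where [e <= |f|] is closed and lies inside the cozero set. *)
Lemma C_supp_sub_C_infty : C_supp R P `<=` C_infty R P.
Proof.
move=> f Pf e e0; have [_ _ _ sP] := idP; apply: sP Pf _ _.
  move=> x /= ex; apply: subset_closure => fx.
  by move: ex; rewrite fx normr0 leNgt e0.
apply: (@closed_comp _ _ (fun x => `|f x|) [set r : R | e <= r]).
  by move=> x _; apply: cvg_norm; exact: cts_fun.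
exact: closed_ge.
Qed.

End closed_set_ideal_theory.

Theorem theorem4p8 (R : realType) (X : topologicalType)
    (hausX : hausdorff_space X) (crX : completely_regular_space X)
    (P : set (set X)) (idP : closed_set_ideal P)
    (isoP : isolated [set: X] = set0 \/ forall x : X, P [set x]) :
  (C_supp R P = socle (continuousType X R) <-> pseudodiscrete P) /\
  (C_infty R P = socle (continuousType X R) <->
     pseudodiscrete P /\ finite_set (isolated [set: X])).
Proof.
have accX := hausdorff_accessible hausX.
have [_ Pclosed _ sP] := idP.
rewrite (socle_finite_cozero accX crX).
(* Both cases of [isoP] are settled here: without isolated points [D] is empty, otherwise it is a
   finite union of singletons in [P]. *)
have Piso D : D `<=` isolated [set: X] -> finite_set D -> P D.
  move=> isoD; apply: (closed_set_ideal_finite idP) => x Dx.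
  by case: isoP => // iso0; have := isoD _ Dx; rewrite iso0.
have socle_supp (f : continuousType X R) :
    finite_set (~` zero_set f) -> C_supp R P f.
  move=> finf; rewrite /C_supp/=.
  rewrite -(closure_id _).1; last exact: (accessible_finite_set_closed.1 accX).
  by apply: Piso => //; apply: open_finite_isolated => //; exact: open_cozero.
have supp_pseudo : C_supp R P `<=` [set f | finite_set (~` zero_set f)] ->
    pseudodiscrete P.
  (* A cozero set inside the interior of the closed set [A] has its closure inside [A], hence in
     [P]. *)
  move=> suppS A PA; have memA (f : continuousType X R) :
      ~` zero_set f `<=` A^° -> finite_set (~` zero_set f).
    move=> fA; apply: suppS; apply: (sP _ _ PA _ (@closed_closure _ _)).
    rewrite [X in _ `<=` X](closure_id A).1; last exact: Pclosed PA.
    by apply: closure_subset; apply: subset_trans fA (@interior_subset _ _).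
  have isoA : A^° `<=` isolated [set: X].
    move=> x Ax; have [||f [fx fN]] :=
      completely_regular_separation (R := R) (x := x) (B := ~` A^°) crX.
    - by apply: open_closedC; exact: open_interior.
    - by apply.
    have finf : finite_set (~` zero_set f).
      by apply: memA => y fy; apply: contrapT => /fN.
    apply: (open_finite_isolated accX (open_cozero f) finf) => /eqP.
    by rewrite fx oner_eq0.
  apply: contrapT => /(exists_infinite_cozero (R := R) accX isoA)[f [inff fA _]].
  exact/inff/memA.
split; split.
- by move=> suppS; apply: supp_pseudo; rewrite suppS.
- move=> pdP; apply/seteqP; split=> // f Pf /=.
  (* The open cozero set lies in the interior of its closure. *)
  apply: sub_finite_set (pdP _ Pf).
  by rewrite -open_subsetE; [exact: subset_closure|exact: open_cozero].
- move=> infS; split.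
    by apply: supp_pseudo; rewrite -infS; exact: C_supp_sub_C_infty.
  apply: contrapT => /(exists_infinite_cozero (R := R) accX (fun=> id)).
  case=> f [inff fiso finf].
  apply: inff; suff : C_infty R P f by rewrite infS.
  move=> e e0; apply: Piso (finf e e0) => x /= ex; apply: fiso => fx.
  by move: ex; rewrite fx normr0 leNgt e0.
- move=> [pdP finiso]; apply/seteqP; split=> [f Pf|f /socle_supp]; last first.
    exact: C_supp_sub_C_infty.
  apply: sub_finite_set finiso => x fx.
  (* Halving leaves room for a strict inequality: the points where [|f|] exceeds [|f x| / 2] form an
     open set around [x] inside a member of [P], so it is finite and [x] is isolated. *)
  have fx0 : 0 < `|f x| / 2 by rewrite divr_gt0// normr_gt0; apply/eqP.
  have oU : open [set y | `|f x| / 2 < `|f y|].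
    apply: (@open_comp _ _ (fun y => `|f y|) [set r : R | `|f x| / 2 < r]).
      by move=> y _; apply: cvg_norm; exact: cts_fun.
    exact: open_gt.
  apply: (open_finite_isolated accX oU) => /=; last first.
    by rewrite ltr_pdivrMr// ltr_pMr ?ltr1n// normr_gt0; apply/eqP.
  apply: sub_finite_set (pdP _ (Pf _ fx0)).
  by rewrite -open_subsetE// => y /ltW.
Qed.
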